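(* Let $B$ be a complete lattice with least element $0_B$ and $\check B=B\setminus\{0_B\}$. The following conditions are equivalent: (a) $B$ is pseudocomplemented. (b) $t$ is a prenucleus on the quantale $\mathcal{Q}\check B$. (c) $\overline{t}$ is a nucleus on $\mathcal{Q}\check B$. (d) $B\,\check\otimes\,B$ is a quantic quotient of $\mathcal{Q}\check B$. (e) $B\,\check\otimes\,B\simeq B\otimes B\simeq Gal(B,B)$ is a quantale (with multiplication $\odot$ on $B\,\check\otimes\,B$, and the corresponding transported multiplications on the isomorphic copies). (f) $B\,\check\otimes\,B\simeq B\otimes B\simeq Gal(B,B)$ is pseudocomplemented. (g) There exists a (pre)nucleus $j$ on $\mathcal{Q}\check B$ with $t\le j$ (pointwise) and $j(\emptyset)=\emptyset$ (the version with ''nucleus'' and the version with ''prenucleus'' are both equivalent to the other conditions). (h) There exist join-preserving order embeddings $g,h$ of $B$ in a quantale $Q$ such that for all $x,y\in B$: $x\wedge y=0_B\Leftrightarrow g(x)\cdot h(y)=0_Q$. (i) For each $\mathcal{X}\subseteq\mathcal{P}B$, $Ant_{\mathcal{X}}(B,B)$ is a quantale. (j) For each $\mathcal{X}\subseteq\mathcal{P}B$, $Ant_{\mathcal{X}}(B,B)$ is pseudocomplemented.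
   Context: A quantale is a complete lattice with an associative multiplication distributing over arbitrary joins on both sides. A preclosure operation on a poset is an extensive, isotone self-map; a closure operation is an idempotent one. For a preclosure operation $j$ on a complete lattice, $\overline{j}$ is the least closure operation above $j$ (it has the same fixpoints). A prenucleus on a quantale $Q$ is a preclosure operation $j$ with $x\cdot j(y)\vee j(x)\cdot y\le j(x\cdot y)$ for all $x,y$; a nucleus is an idempotent prenucleus. A quantic quotient of $Q$ is the fixpoint set of a nucleus on $Q$. A complete lattice is pseudocomplemented if for each $x$ there is a greatest $y$ with $x\wedge y=0$. $\mathcal{Q}\check B$ is the set of all down-sets of $\check B\times\check B$ (componentwise order), ordered by inclusion; it is a quantale with the relation product $R\cdot S=\{(a,c):\exists b\ (a,b)\in R,\ (b,c)\in S\}$. For $X\subseteq \check B$, $\check\Delta X$ is the intersection of all principal ideals of the poset $\check B$ containing $X$. The preclosure operation $t$ on $\mathcal{Q}\check B$ is $t(R)=\bigcup\{\check\Delta X\times\check\Delta Y: X,Y\subseteq\check B,\ \emptyset\neq X\times Y\subseteq R\}$. $B\otimes B$ is the set, ordered by inclusion, of all down-sets $T$ of $B\times B$ such that $X\times Y\subseteq T$ implies $(\bigvee X,\bigvee Y)\in T$ for all $X,Y\subseteq B$. $B\,\check\otimes\,B$ is the set, ordered by inclusion, of fixpoints of $t$, i.e. of all down-sets $T$ of $\check B\times\check B$ such that $X\times Y\subseteq T$ implies $(\bigvee X,\bigvee Y)\in T$ for all nonempty $X,Y\subseteq \check B$. Its multiplication is $R\odot S=\overline{t}(R\cdot S)$,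 the least member of $B\,\check\otimes\,B$ containing $R\cdot S$. $Gal(B,B)$ is the pointwise ordered set of all maps $f:B\to B$ with $f(\bigvee X)=\bigwedge f[X]$ for all $X\subseteq B$. With $\overline{\emptyset}=(\{0_B\}\times B)\cup(B\times\{0_B\})$, the map $T\mapsto T\setminus\overline{\emptyset}$ is an isomorphism $B\otimes B\to B\,\check\otimes\,B$, and $f\mapsto\{(x,y)\in\check B\times\check B: f(x)\ge y\}$ is an isomorphism $Gal(B,B)\to B\,\check\otimes\,B$; the multiplication is transported along these. For $\mathcal{X}\subseteq\mathcal{P}B$ (power set), $Ant_{\mathcal{X}}(B,B)$ is the pointwise ordered complete lattice of all antitone maps $f:B\to B$ with $f(\bigvee X)=\bigwedge f[X]$ for all $X\in\mathcal{X}$. Put $\bot_{\mathcal{X}}=\{0_B\}$ if $\emptyset\in\mathcal{X}$ and $\bot_{\mathcal{X}}=\emptyset$ otherwise. Let $B_{\mathcal{X}}\,\check\otimes\,B$ be the set of all down-sets $T$ of $(B\setminus\bot_{\mathcal{X}})\times\check B$ such that (1) for each $x$, $\{y:(x,y)\in T\}$ is closed under joins of nonempty subsets, and (2) for each $y$ and each $X\in\mathcal{X}$ with $\emptyset\ne X\setminus\bot_{\mathcal{X}}\subseteq\{x:(x,y)\in T\}$, one has $(\bigvee X,y)\in T$. The map $f\mapsto\check T_f=\{(x,y)\in (B\setminus\bot_{\mathcal{X}})\times\check B: f(x)\ge y\}$ is an isomorphism $Ant_{\mathcal{X}}(B,B)\to B_{\mathcal{X}}\,\check\otimes\,B$ (ordered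 by inclusion). The multiplication on $Ant_{\mathcal{X}}(B,B)$ is the transported one: $g\odot f$ is the $h\in Ant_{\mathcal{X}}(B,B)$ for which $\check T_h$ is the least member of $B_{\mathcal{X}}\,\check\otimes\,B$ containing the relation product $\check T_f\cdot\check T_g$. *)

(* Defs.v *)
From HB Require Import structures.
From mathcomp Require Import all_boot all_order.
From mathcomp Require Export boolp classical_sets.

Set Implicit Arguments.
Unset Strict Implicit.
Unset Printing Implicit Defensive.

Import Order.TTheory.
Local Open Scope classical_set_scope.
Local Open Scope order_scope.

Definition complete_poset d (P : porderType d) : Prop :=
  forall X : set P, supremums X !=set0.

HB.mixin Record isComplete d T of Order.TBLattice d T := {
  complete_subproof : complete_poset T }.

#[short(type="completeLatticeType")]
HB.structure Definition CompleteLattice d :=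
  {T of Order.TBLattice d T & isComplete d T}.

Section OrderNotions.
Context d (P : porderType d).

(* The meet of x and y exists and is the least element of P. *)
Definition meet_is_least (x y : P) : Prop :=
  exists2 z, infimums [set x; y] z & lbound [set: P] z.

Definition pseudocomplemented : Prop :=
  forall x : P, exists2 y, meet_is_least x y &
                           forall z, meet_is_least x z -> z <= y.

Definition preclosure (j : P -> P) : Prop :=
  (forall x, x <= j x) /\ {homo j : x y / x <= y}.

Definition closure_op (j : P -> P) : Prop :=
  preclosure j /\ forall x, j (j x) = j x.

Definition least_closure_above (j k : P -> P) : Prop :=
  [/\ closure_op k, forall x, j x <= k x &
      forall k', closure_op k' -> (forall x, j x <= k' x) ->
                 forall x, k x <= k' x].

(* No unit is required. *)
Definition is_quantale (mul : P -> P -> P) : Prop :=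
  [/\ complete_poset P, associative mul,
      forall x (Y : set P) s, supremums Y s ->
        supremums [set mul x y | y in Y] (mul x s) &
      forall x (Y : set P) s, supremums Y s ->
        supremums [set mul y x | y in Y] (mul s x)].

Definition prenucleus (mul : P -> P -> P) (j : P -> P) : Prop :=
  preclosure j /\
  forall x y, mul x (j y) <= j (mul x y) /\ mul (j x) y <= j (mul x y).

Definition nucleus (mul : P -> P -> P) (j : P -> P) : Prop :=
  prenucleus mul j /\ forall x, j (j x) = j x.

Definition quantic_quotient (mul : P -> P -> P) (F : set P) : Prop :=
  exists2 j, nucleus mul j & F = [set x | j x = x].

End OrderNotions.

Section Maps.
Context d (P : porderType d) d' (P' : porderType d').

Definition join_preserving (f : P -> P') : Prop :=
  forall (X : set P) s, supremums X s -> supremums (f @` X) (f s).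

Definition order_embedding (f : P -> P') : Prop :=
  {mono f : x y / x <= y}.

Definition order_iso (f : P -> P') : Prop :=
  bijective f /\ order_embedding f.

(* P is a quantale for the multiplication transported from P' along the
   bijection f; that multiplication is unique since f is injective. *)
Definition transported_quantale (f : P -> P') (mul' : P' -> P' -> P') : Prop :=
  exists2 mul : P -> P -> P,
    {morph f : x y / mul x y >-> mul' x y} & is_quantale mul.

End Maps.

Section CompleteLatticeTheory.
Context d (B : completeLatticeType d).
Implicit Types (x y : B) (X Y : set B).

Lemma supremumsP X : supremums X (supremum \bot X).
Proof.
rewrite /supremum; case: ifPn => [/eqP ->|_].
  by split=> [x []|x _]; exact: le0x.
have [s Xs] := @complete_subproof d B X.
exact: (xgetPex _ (ex_intro _ s Xs)).
Qed.

Lemma sup_ub X x : X x -> x <= supremum \bot X.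
Proof. exact: (proj1 (supremumsP X)). Qed.

Lemma sup_le X x : ubound X x -> supremum \bot X <= x.
Proof. exact: (proj2 (supremumsP X)). Qed.

Lemma infimumsP X : infimums X (infimum \top X).
Proof.
rewrite /infimum; case: ifPn => [/eqP ->|_].
  by split=> [x []|x _]; exact: lex1.
suff Xs : infimums X (supremum \bot (lbound X)).
  exact: (xgetPex _ (ex_intro _ _ Xs)).
split=> [x Xx|x lx]; last exact: sup_ub.
by apply: sup_le => y; apply.
Qed.

End CompleteLatticeTheory.

Definition rprod (T : Type) (R S : set (T * T)) : set (T * T) :=
  [set p | exists b, R (p.1, b) /\ S (b, p.2)].

(* T is a down-set of D, where D carries the componentwise order. *)
Definition downset_in d (B : porderType d) (D T : set (B * B)) : Prop :=
  T `<=` D /\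
  forall p q, T p -> D q -> q.1 <= p.1 -> q.2 <= p.2 -> T q.

(* B with its least element removed; relations on it are represented as
   subsets of B * B contained in the square of nzB. *)
Definition nzB d (B : completeLatticeType d) : set B := [set x | x != \bot].
Arguments nzB {d} B.

Section QB.
Context d (B : completeLatticeType d).

Record qB := QB {
  qB_val :> set (B * B);
  qB_valP : `[< downset_in (nzB B `*` nzB B) qB_val >] }.

HB.instance Definition _ := [isSub for qB_val].
HB.instance Definition _ := [Choice of qB by <:].
HB.instance Definition _ :=
  [SubChoice_isSubPOrder of qB by <: with set_display].

Lemma qB_leP (R S : qB) : (R <= S) <-> ((R : set _) `<=` S).
Proof. by rewrite -Order.le_val; split=> /asboolP. Qed.

Lemma qB_eqP (R S : qB) : (R : set _) = S -> R = S.
Proof. exact: val_inj. Qed.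

Lemma qB_down (R : qB) : downset_in (nzB B `*` nzB B) R.
Proof. exact/asboolP/qB_valP. Qed.

Lemma qmul_subproof (R S : qB) :
  `[< downset_in (nzB B `*` nzB B) (rprod R S) >].
Proof.
have [Rs Rd] := qB_down R; have [Ss Sd] := qB_down S.
apply/asboolP; split=> [p [b [Rb Sb]]|p q [b [Rb Sb]] [q1 q2] l1 l2].
  by split; [case: (Rs _ Rb)|case: (Ss _ Sb)].
have nb : nzB B b by case: (Rs _ Rb).
by exists b; split; [apply: (Rd _ (q.1, b) Rb)|apply: (Sd _ (b, q.2) Sb)].
Qed.

Definition qmul (R S : qB) : qB := QB (qmul_subproof R S).

Lemma q0_subproof : `[< downset_in (nzB B `*` nzB B) set0 >].
Proof. by apply/asboolP; split. Qed.

Definition q0 : qB := QB q0_subproof.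

(* The intersection, within nzB, of all principal ideals of nzB that
   contain X; it is nzB if there are none. *)
Definition cut (X : set B) : set B :=
  [set a | nzB B a /\
           forall b, nzB B b -> (forall x, X x -> x <= b) -> a <= b].

Definition t_set (R : set (B * B)) : set (B * B) :=
  [set p | exists X Y, [/\ X `<=` nzB B, Y `<=` nzB B, X `*` Y !=set0,
                           X `*` Y `<=` R & (cut X `*` cut Y) p]].

Lemma t_subproof (R : qB) : `[< downset_in (nzB B `*` nzB B) (t_set R) >].
Proof.
apply/asboolP; split=> [p [X [Y [_ _ _ _ [[p1 _] [p2 _]]]]] //|].
move=> p q [X [Y [Xs Ys ne XY [[p1 c1] [p2 c2]]]]] [q1 q2] l1 l2.
exists X, Y; split=> //; split; split=> // b nb ub.
  exact: le_trans l1 (c1 b nb ub).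
exact: le_trans l2 (c2 b nb ub).
Qed.

Definition t (R : qB) : qB := QB (t_subproof R).

Lemma t_preclosure : preclosure t.
Proof.
split=> [R|R S /qB_leP RS]; apply/qB_leP.
  case=> a b Rab; have [[na nb] _] : (nzB B `*` nzB B) (a, b) /\ True.
    by split=> //; case: (qB_down R) => Rs _; exact: Rs.
  exists [set a], [set b]; split=> [x ->|x ->||[x y] [/= -> ->]|] //.
    by exists (a, b).
  by split; split=> // c _; apply.
move=> p [X [Y [Xs Ys ne XY c]]]; exists X, Y; split=> //.
exact: subset_trans XY RS.
Qed.

Definition tbar_set (R : qB) : set (B * B) :=
  \bigcap_(S in [set S : qB | t S = S /\ R <= S]) (S : set (B * B)).

Lemma tbar_subproof (R : qB) :
  `[< downset_in (nzB B `*` nzB B) (tbar_set R) >].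
Proof.
have fullP : `[< downset_in (nzB B `*` nzB B) (nzB B `*` nzB B) >].
  by apply/asboolP; split.
apply/asboolP; split=> [p Hp|p q Hp Dq l1 l2 S [tS RS]].
  apply: (Hp (QB fullP)); split.
    apply: le_anti; rewrite (proj1 t_preclosure) andbT.
    by apply/qB_leP; case: (qB_down (t (QB fullP))).
  by apply/qB_leP; case: (qB_down R).
by have [_ Sd] := qB_down S; apply: Sd (Hp S _) Dq l1 l2; split.
Qed.

Definition tbar (R : qB) : qB := QB (tbar_subproof R).

Lemma t_tbar (R : qB) : t (tbar R) = tbar R.
Proof.
apply: le_anti; rewrite (proj1 t_preclosure) andbT; apply/qB_leP => p Hp.
move=> S [tS RS]; rewrite -tS; move: p Hp; apply/qB_leP.
apply: (proj2 t_preclosure); apply/qB_leP => p; apply; split=> //.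
Qed.

Lemma tbar_least (R S : qB) : t S = S -> R <= S -> tbar R <= S.
Proof. by move=> tS RS; apply/qB_leP => p; apply; split. Qed.

Lemma tbar_ext (R : qB) : R <= tbar R.
Proof. by apply/qB_leP => p Rp S [_ /qB_leP]; apply. Qed.

Lemma tbarP : least_closure_above t tbar.
Proof.
split.
- split; [split=> [|R S RS]|move=> R].
  + exact: tbar_ext.
  + by apply: tbar_least (t_tbar S) (le_trans RS (tbar_ext S)).
  + by apply: le_anti; rewrite tbar_ext andbT; apply: tbar_least (t_tbar R) _.
- by move=> R; rewrite -[leRHS]t_tbar; apply: (proj2 t_preclosure) (tbar_ext R).
- move=> k [[kext _] kid] tk R; apply: tbar_least (kext R).
  by apply: le_anti; rewrite (proj1 t_preclosure) andbT -{2}kid tk.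
Qed.

Record ctens := CTens { ctens_val :> qB; ctens_valP : t ctens_val == ctens_val }.

HB.instance Definition _ := [isSub for ctens_val].
HB.instance Definition _ := [Choice of ctens by <:].
HB.instance Definition _ :=
  [SubChoice_isSubPOrder of ctens by <: with set_display].

Lemma odot_subproof (R S : ctens) :
  t (tbar (qmul R S)) == tbar (qmul R S).
Proof. exact/eqP/t_tbar. Qed.

Definition odot (R S : ctens) : ctens := CTens (odot_subproof R S).

Lemma t_fixP (R : qB) :
  t R = R <->
  forall X Y, X `<=` nzB B -> Y `<=` nzB B -> X !=set0 -> Y !=set0 ->
    X `*` Y `<=` R -> (R : set _) (supremum \bot X, supremum \bot Y).
Proof.
have nzsup X : X `<=` nzB B -> X !=set0 -> nzB B (supremum \bot X).
  move=> Xs [x Xx]; rewrite /nzB /= -lt0x.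
  by apply: lt_le_trans (sup_ub Xx); rewrite lt0x; exact: Xs.
split=> [tR X Y Xs Ys X0 Y0 XY|H].
  rewrite -tR; exists X, Y; split=> //.
    by case: X0 Y0 => x Xx [y Yy]; exists (x, y).
  by split; split; do ?[exact: nzsup] => b _ ub; apply: sup_le.
apply: le_anti; rewrite (proj1 t_preclosure) andbT; apply/qB_leP => p.
case=> X [Y [Xs Ys [[x y] [/= Xx Yy]] XY [[n1 c1] [n2 c2]]]].
have X0 : X !=set0 by exists x.
have Y0 : Y !=set0 by exists y.
have [_ Rd] := qB_down R; apply: Rd (H X Y Xs Ys X0 Y0 XY) _ _ _ => //=.
  by apply: c1 => [|z]; [exact: nzsup|exact: sup_ub].
by apply: c2 => [|z]; [exact: nzsup|exact: sup_ub].
Qed.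

Definition tens_cond (T : set (B * B)) : Prop :=
  downset_in [set: B * B] T /\
  forall X Y, X `*` Y `<=` T -> T (supremum \bot X, supremum \bot Y).

Record tens := Tens { tens_val :> set (B * B);
                      tens_valP : `[< tens_cond tens_val >] }.

HB.instance Definition _ := [isSub for tens_val].
HB.instance Definition _ := [Choice of tens by <:].
HB.instance Definition _ :=
  [SubChoice_isSubPOrder of tens by <: with set_display].

Definition gal_cond (f : B -> B) : Prop :=
  forall X, f (supremum \bot X) = infimum \top (f @` X).

Record gal := Gal { gal_val :> B -> B; gal_valP : `[< gal_cond gal_val >] }.

HB.instance Definition _ := [isSub for gal_val].
HB.instance Definition _ := [Choice of gal by <:].
HB.instance Definition _ :=
  [SubChoice_isSubPOrder of gal by <: with d].

(* The least element of B (x) B. *)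
Definition bot_tens : set (B * B) := [set p | p.1 = \bot \/ p.2 = \bot].

Lemma tens_qB_subproof (T : tens) :
  `[< downset_in (nzB B `*` nzB B) (T `\` bot_tens) >].
Proof.
have [[_ Td] _] := asboolW (tens_valP T).
apply/asboolP; split=> [p [_ nz]|p q [Tp _] [/= n1 n2] l1 l2].
  by split; apply/eqP => e; apply: nz; [left|right].
split; first exact: Td Tp _ l1 l2.
by case=> [/eqP|/eqP]; [rewrite (negPf n1)|rewrite (negPf n2)].
Qed.

Lemma tens_ctens_subproof (T : tens) :
  t (QB (tens_qB_subproof T)) == QB (tens_qB_subproof T).
Proof.
have [_ Ts] := asboolW (tens_valP T).
apply/eqP/t_fixP => X Y Xs Ys [x Xx] [y Yy] XY /=; split.
  by apply: Ts => p /XY [].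
case=> /= e.
  by have := Xs _ Xx; rewrite /nzB /= -lex0 -e sup_ub.
by have := Ys _ Yy; rewrite /nzB /= -lex0 -e sup_ub.
Qed.

Definition tens_ctens (T : tens) : ctens := CTens (tens_ctens_subproof T).

Lemma gal_qB_subproof (f : gal) :
  `[< downset_in (nzB B `*` nzB B)
        [set p | [/\ nzB B p.1, nzB B p.2 & p.2 <= f p.1]] >].
Proof.
have fg := asboolW (gal_valP f).
have anti x y : x <= y -> f y <= f x.
  move=> xy; have <- : supremum \bot [set x; y] = y.
    apply: le_anti; rewrite sup_ub ?andbT; last by right.
    by apply: sup_le => z [] ->.
  by rewrite fg; apply: (proj1 (infimumsP _)); exists x => //; left.
apply/asboolP; split=> [p []|p q [_ _ l] [n1 n2] l1 l2] //; split=> //.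
exact: le_trans l2 (le_trans l (anti _ _ l1)).
Qed.

Lemma gal_ctens_subproof (f : gal) :
  t (QB (gal_qB_subproof f)) == QB (gal_qB_subproof f).
Proof.
have fg := asboolW (gal_valP f).
apply/eqP/t_fixP => X Y Xs Ys [x Xx] [y Yy] XY /=.
have nzsup Z z : Z `<=` nzB B -> Z z -> nzB B (supremum \bot Z).
  move=> Zs Zz; rewrite /nzB /= -lt0x.
  by apply: lt_le_trans (sup_ub Zz); rewrite lt0x; exact: Zs.
split; [exact: nzsup Xx|exact: nzsup Yy|rewrite fg].
apply: sup_le => z Yz; apply: (proj2 (infimumsP _)) => _ [u Xu <-].
by case: (XY (u, z)).
Qed.

Definition gal_ctens (f : gal) : ctens := CTens (gal_ctens_subproof f).

End QB.

Section Ant.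
Context d (B : completeLatticeType d) (XX : set (set B)).

Definition ant_cond (f : B -> B) : Prop :=
  {homo f : x y /~ x <= y} /\
  forall X, XX X -> f (supremum \bot X) = infimum \top (f @` X).

Record ant := Ant { ant_val :> B -> B; ant_valP : `[< ant_cond ant_val >] }.

HB.instance Definition _ := [isSub for ant_val].
HB.instance Definition _ := [Choice of ant by <:].
HB.instance Definition _ :=
  [SubChoice_isSubPOrder of ant by <: with d].

Definition botX : set B := [set x | XX set0 /\ x = \bot].

Definition ant_tens (T : set (B * B)) : Prop :=
  [/\ downset_in (~` botX `*` nzB B) T,
      forall x Y, Y !=set0 -> (forall y, Y y -> T (x, y)) ->
        T (x, supremum \bot Y) &
      forall y X, XX X -> X `\` botX !=set0 ->
        (forall x, (X `\` botX) x -> T (x, y)) -> T (supremum \bot X, y)].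

Definition ant_rel (f : B -> B) : set (B * B) :=
  [set p | [/\ (~` botX) p.1, nzB B p.2 & p.2 <= f p.1]].

(* mul g f is the map whose relation is the least member of ant_tens that
   contains the product of the relations of f and g, in this order; as ant_rel
   is injective on ant, this determines mul. *)
Definition is_ant_mul (mul : ant -> ant -> ant) : Prop :=
  forall g f, [/\ ant_tens (ant_rel (mul g f)),
    rprod (ant_rel f) (ant_rel g) `<=` ant_rel (mul g f) &
    forall T, ant_tens T -> rprod (ant_rel f) (ant_rel g) `<=` T ->
              ant_rel (mul g f) `<=` T].

Definition ant_quantale : Prop :=
  exists2 mul, is_ant_mul mul & is_quantale mul.

End Ant.

(* Main.v *)
Require Import Defs.
From HB Require Import structures.
From mathcomp Require Import all_boot all_order.
From mathcomp Require Import boolp classical_sets.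

Set Implicit Arguments.
Unset Strict Implicit.
Unset Printing Implicit Defensive.

Import Order.TTheory.
Local Open Scope classical_set_scope.
Local Open Scope order_scope.

(** Each of the conditions says, in its own language, that an element disjoint
    from every member of a set is disjoint from the join of the set; in a
    complete lattice this is the existence of pseudocomplements
    ([pseudocomplementedP]). Equivalently, an element that meets a join meets
    one of the joinands ([meets_sup]).

    From pseudocomplements to the other conditions. The elements of
    [ctens B], [tens B], [gal B] and every [ant XX] are, up to order
    isomorphism, the down-sets of a rectangle of [B * B] that satisfy
    [ant_tens] ([represents]). When relations are composed through a middle
    variable [b], and [b] lies below a join in the closure of one factor,
    [meets_sup] replaces [b] by a smaller nonzero element below one of the
    joinands. For one step of [t] this is the prenucleus inequality
    ([t_prenucleus]). For closed relations it shows that their residuals are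
    closed ([residual_left], [residual_right]), from which associativity and
    distributivity of the induced multiplication follow
    ([represents_quantale]), and also that [tbar] is a nucleus
    ([tbar_nucleus]). For intersections instead of products, it shows that the
    pairs having no common lower bound with a closed relation form a closed
    relation ([ant_tens_pseudocomplement]).

    Conversely, bounding the second coordinate by [x], or the first coordinate
    by [y], embeds [B] twice into the relations closed for all subsets, and
    the product of the two rectangles is empty exactly when [x] and [y] are
    disjoint ([rect_embeddings], [rprod_rect]). Since the embeddings preserve
    joins, distributivity of the multiplication carries disjointness over to
    joins ([pseudocomplemented_of_quantale]), and so does the existence of
    pseudocomplements ([pseudocomplemented_pullback]). For a prenucleus above
    [t] that fixes the empty relation, the same rectangles are used with the
    union of the second ones in place of their join
    ([pseudocomplemented_of_prenucleus]). *)

(** * Pseudocomplements and quantales in ordered sets *)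

Section Generalities.
Context d (P : porderType d).
Implicit Types (mul : P -> P -> P).

(** Under this hypothesis multiplication by a fixed element has an upper
    adjoint on either side, and lower adjoints preserve all suprema. *)
Lemma residuated_quantale mul :
  complete_poset P -> associative mul ->
  (forall x z, exists r, forall y, mul x y <= z <-> y <= r) ->
  (forall x z, exists r, forall y, mul y x <= z <-> y <= r) ->
  is_quantale mul.
Proof.
have adjoint_sup (f : P -> P) (Y : set P) s :
    (forall z, exists r, forall y, f y <= z <-> y <= r) ->
    supremums Y s -> supremums [set f y | y in Y] (f s).
  move=> adj [ub lub]; split=> [_ [y Yy <-]|z zub].
    by have [r rP] := adj (f s); apply/rP; apply: le_trans (ub _ Yy) _; apply/rP.
  have [r rP] := adj z; apply/rP; apply: lub => y Yy; apply/rP.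
  by apply: zub; exists y.
move=> complP assoc resl resr; split=> // x Y s; exact: adjoint_sup.
Qed.

Lemma is_quantale_opp mul :
  is_quantale mul -> is_quantale (fun x y => mul y x).
Proof. by case=> complP assoc dl dr; split=> // x y z; rewrite assoc. Qed.

(** Surjectivity yields an inverse by choice, and order reflection yields
    injectivity by antisymmetry. *)
Lemma order_isoP d' (P' : porderType d') (f : P -> P') :
  order_embedding f -> (forall y, exists x, f x = y) -> order_iso f.
Proof.
move=> emb surj; split=> //; exists (fun y => sval (cid (surj y))) => [x|y].
  by apply: (inc_inj emb); case: (cid _).
by case: (cid _).
Qed.

End Generalities.

Section Lattice.
Context d (B : completeLatticeType d).
Implicit Types (x y z : B) (X Y : set B).

Lemma meet_is_leastP x y : meet_is_least x y <-> x `&` y = \bot.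
Proof.
split=> [[z [_ glb] least]|xy0].
  apply/eqP; rewrite -lex0; apply: le_trans (least \bot I).
  by apply: glb => _ [] ->; [exact: leIl|exact: leIr].
exists \bot => [|z _]; last exact: le0x.
split=> [z _|z zlb]; first exact: le0x.
by rewrite -xy0 lexI !zlb //; [right|left].
Qed.

(** The only elements that a pseudocomplement of [x] has to dominate are those
    disjoint from [x], so it exists exactly when their supremum is still
    disjoint from [x]. *)
Lemma pseudocomplementedP :
  pseudocomplemented B <->
  forall x Y, (forall y, Y y -> x `&` y = \bot) ->
              x `&` supremum \bot Y = \bot.
Proof.
split=> [pc x Y xY|H x].
  have [s /meet_is_leastP xs maxs] := pc x.
  apply/eqP; rewrite -lex0; apply: (@le_trans _ _ (x `&` s)); last by rewrite xs.
  by rewrite leI2 //; apply: sup_le => y /xY xy; exact/maxs/meet_is_leastP.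
exists (supremum \bot [set y | x `&` y = \bot]).
  by apply/meet_is_leastP/H.
by move=> z /meet_is_leastP xz; apply: sup_ub.
Qed.

(** The form in which pseudocomplementation is used: an element meets a
    supremum only by meeting one of its members. *)
Lemma meets_sup x Y :
  pseudocomplemented B -> x `&` supremum \bot Y != \bot ->
  exists2 y, Y y & x `&` y != \bot.
Proof.
rewrite pseudocomplementedP => pc nz; apply: contrapT => none.
case/negP: nz; apply/eqP/pc => y Yy; apply/eqP; apply: contrapT => /negP xy.
by apply: none; exists y.
Qed.

(** A pseudocomplement in [P] transfers back along a join-preserving map that
    preserves and reflects disjointness. *)
Lemma pseudocomplemented_pullback d' (P : porderType d') (h : B -> P) :
  join_preserving h ->
  (forall x y, x `&` y = \bot <-> meet_is_least (h x) (h y)) ->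
  pseudocomplemented P -> pseudocomplemented B.
Proof.
move=> hsup hmeet pc; apply/pseudocomplementedP => x Y xY; apply/hmeet.
have [p [z [zlb zglb] zleast] pmax] := pc (h x).
have hp : h (supremum \bot Y) <= p.
  have [_ lub] := hsup _ _ (supremumsP Y); apply: lub => _ [y Yy <-].
  exact/pmax/hmeet/xY.
exists z => //; split=> [u _|u ulb]; first exact: zleast.
apply: zglb => _ [] ->; first by apply: ulb; left.
by apply: le_trans hp; apply: ulb; right.
Qed.

(** Distributivity turns the supremum of the products [mul (g x) (h y)], all
    of them least, into the single product at the supremum of the [y]. *)
Lemma pseudocomplemented_of_quantale d' (Q : porderType d')
    (mul : Q -> Q -> Q) (g h : B -> Q) :
  is_quantale mul -> join_preserving h ->
  (forall x y, x `&` y = \bot <-> lbound [set: Q] (mul (g x) (h y))) ->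
  pseudocomplemented B.
Proof.
move=> [_ _ distr _] hsup gh; apply/pseudocomplementedP => x Y xY; apply/gh.
have [_ lub] := distr (g x) _ _ (hsup _ _ (supremumsP Y)).
move=> q _; apply: lub => _ [_ [y Yy <-] <-].
by have /gh := xY _ Yy; apply.
Qed.

Lemma supremum_unique X x : supremums X x -> supremum \bot X = x.
Proof.
case=> ub lub; apply: le_anti; rewrite (sup_le ub) /=.
by apply: lub => y; exact: sup_ub.
Qed.

Lemma supremum1 x : supremum \bot [set x] = x.
Proof. by apply: supremum_unique; split=> [y -> //|y]; apply. Qed.

Lemma supremum_nz X : supremum \bot (X `&` nzB B) = supremum \bot X.
Proof.
apply: le_anti; apply/andP; split.
  by apply: sup_le => x [Xx _]; apply: sup_ub.
apply: sup_le => x Xx; have [->|nx] := eqVneq x \bot; first exact: le0x.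
exact: sup_ub.
Qed.

Lemma nzB_up x y : nzB B x -> x <= y -> nzB B y.
Proof. by rewrite /nzB /= -!lt0x; exact: lt_le_trans. Qed.

Lemma nzB_sup X : X `<=` nzB B -> X !=set0 -> nzB B (supremum \bot X).
Proof. by move=> Xs [x Xx]; apply: nzB_up (Xs _ Xx) (sup_ub Xx). Qed.

Lemma sup_nz_ex X : nzB B (supremum \bot X) -> (X `&` nzB B) !=set0.
Proof.
move=> nz; apply/set0P/eqP => X0; move: nz; rewrite -supremum_nz X0 /nzB /=.
by rewrite -lex0 sup_le.
Qed.

End Lattice.

(** * The closed relations of an antitone map space *)

Section ClosedRelations.
Context d (B : completeLatticeType d) (XX : set (set B)).
Implicit Types (x y : B) (X Y : set B) (T R S : set (B * B)).

Local Notation bX := (@botX d B XX).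
Local Notation dom := (~` bX `*` nzB B).
Local Notation down := (@downset_in d B dom).

Lemma nzB_dom x : nzB B x -> ~ bX x.
Proof. by move=> /eqP nx [_]. Qed.

Lemma dom_up x y : x <= y -> ~ bX x -> ~ bX y.
Proof.
move=> xy nx [X0 y0]; apply: nx; split=> //; apply/eqP.
by rewrite -lex0 -y0.
Qed.

Lemma ant_tensP T : ant_tens XX T <->
  [/\ down T,
      forall x Y, Y !=set0 -> (forall y, Y y -> T (x, y)) ->
        T (x, supremum \bot Y) &
      forall y X, XX X -> X `\` bX !=set0 ->
        (forall x, X x -> ~ bX x -> T (x, y)) -> T (supremum \bot X, y)].
Proof.
split=> -[Td T1 T2]; split=> // y X XXX X0 H; apply: T2 => // x.
  by case=> Xx nx; exact: H.
by move=> Xx nx; apply: H.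
Qed.

Lemma dom_sup X : X `\` bX !=set0 -> ~ bX (supremum \bot X).
Proof. by case=> x [Xx nx]; apply: dom_up nx; exact: sup_ub. Qed.

(** If [botX] is empty, every pair of elements meets inside the domain, and
    any member of [X] will do; otherwise the domain is [nzB], and [meets_sup]
    provides the member. *)
Lemma dom_meets_sup X a :
  pseudocomplemented B -> X `\` bX !=set0 ->
  ~ bX (a `&` supremum \bot X) ->
  exists x, [/\ X x, ~ bX x & ~ bX (a `&` x)].
Proof.
move=> pc [x [Xx nx]] nax.
have [nax0|/contrapT [X0 ax0]] := pselect (~ bX (a `&` x)).
  by exists x.
have [|u Xu au] := @meets_sup _ _ a X pc.
  by apply/eqP => e; apply: nax.
exists u; split=> //; last exact: nzB_dom.
by move=> -[_ u0]; case/eqP: au; rewrite u0 meetx0.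
Qed.

Lemma ant_tens_down T : ant_tens XX T -> down T.
Proof. by case. Qed.

(** Intersecting with the whole domain makes this a closed relation even for
    an empty family. *)
Lemma ant_tens_cap (F : set (set (B * B))) :
  F `<=` ant_tens XX ->
  ant_tens XX [set p | dom p /\ forall T, F T -> T p].
Proof.
move=> Fc; apply/ant_tensP; split.
- split=> [p []//|p q [_ Fp] Dq l1 l2]; split=> // T FT.
  by have [[_ Td] _ _] := Fc _ FT; apply: Td (Fp _ FT) _ _ _.
- move=> x Y Y0 H; split.
    case: (Y0) => y /H [[/= nx _] _]; split=> //=; apply: nzB_sup => // z.
    by case/H => -[].
  by move=> T FT; have [_ T1 _] := Fc _ FT; apply: T1 => // y /H [_]; apply.
- move=> y X XXX X0 H; split.
    case: (X0) => x [Xx nx]; have [[/= _ ny] _] := H x Xx nx.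
    by split=> //=; exact: dom_sup.
  move=> T FT; have /ant_tensP[_ _ T2] := Fc _ FT.
  by apply: T2 => // x Xx nx; have [_] := H x Xx nx; apply.
Qed.

Lemma ant_tens0 : ant_tens XX set0.
Proof.
apply/ant_tensP.
split=> [|x Y [y Yy] /(_ _ Yy)//|y X _ [x [Xx nx]] /(_ _ Xx nx)//].
by split=> // ? ?.
Qed.

Lemma rprod_down R S : down R -> down S -> down (rprod R S).
Proof.
move=> [Rs Rd] [Ss Sd]; split=> [p [b [Rb Sb]]|p q [b [Rb Sb]] [q1 q2] l1 l2].
  by split; [case: (Rs _ Rb)|case: (Ss _ Sb)].
have [[pb bb] [_ p2]] := (Rs _ Rb, Ss _ Sb).
by exists b; split; [apply: (Rd _ (q.1, b) Rb)|
  apply: (Sd _ (b, q.2) Sb) => //; split=> //; exact: nzB_dom].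
Qed.

Lemma rprodA R S T : rprod R (rprod S T) = rprod (rprod R S) T.
Proof.
apply/seteqP; split=> p.
  by case=> b [Rb [c [Sc Tc]]]; exists c; split=> //; exists b.
by case=> c [[b [Rb Sc]] Tc]; exists b; split=> //; exists c.
Qed.

(** The pairs [(a, b)] of the residual have to be tested at all [b' <= b]: a
    down-set [S] may contain [(b', c)] without containing [(b, c)], so testing
    at [b] alone would not define a down-set. Closure under joins in [b] holds
    because a nonzero [b'] below a join meets one of the joinands. *)
Lemma residual_left S T : pseudocomplemented B -> down S -> ant_tens XX T ->
  exists2 Z, ant_tens XX Z &
    forall R, down R -> (rprod R S `<=` T <-> R `<=` Z).
Proof.
move=> pc [Ss Sd] /ant_tensP[[Ts Td] T1 T2].
exists [set p | dom p /\
    forall b c, b <= p.2 -> S (b, c) -> nzB B b -> T (p.1, c)].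
- apply/ant_tensP; split.
  + split=> [p []//|p q [_ Hp] Dq l1 l2]; split=> // b c bq Sbc nb.
    apply: (Td _ _ (Hp b c (le_trans bq l2) Sbc nb)) => //=.
    by split; [case: Dq|case: (Ss _ Sbc)].
  + move=> x Y [y0 Yy0] H; split.
      have [[/= nx _] _] := H _ Yy0; split=> //=; apply: nzB_sup; last by exists y0.
      by move=> y /H [[]].
    move=> b c /= bY Sbc nb.
    have [|y Yy by0] := @meets_sup _ _ b Y pc; first by rewrite (meet_l bY).
    have [_ /= /(_ (b `&` y) c (leIr _ _))] := H _ Yy; apply=> //.
    apply: (Sd _ _ Sbc) => //=; last exact: leIl.
    by split; [exact: nzB_dom|case: (Ss _ Sbc)].
  + move=> y X XXX X0 H; split.
      case: (X0) => x [Xx nx]; have [[/= _ ny] _] := H x Xx nx.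
      by split=> //=; exact: dom_sup.
    move=> b c /= bY Sbc nb; apply: T2 => // x Xx nx.
    by have [_ /= Hx] := H x Xx nx; exact: Hx bY Sbc nb.
- move=> R [Rs Rd]; split=> [RST p Rp|RZ p [b [Rb Sb]]].
    split; first exact: Rs.
    move=> b c bp Sbc nb; apply: RST; exists b; split=> //=.
    by apply: (Rd _ _ Rp) => //; split=> //=; case: (Rs _ Rp).
  have [[_ /= nb] H] := RZ _ Rb.
  by have := H b p.2 (lexx _) Sb nb; case: (p).
Qed.

(** Here the middle variable is the first coordinate, and it is the closure
    under joins along [XX] that uses pseudocomplements. *)
Lemma residual_right R T : pseudocomplemented B -> down R -> ant_tens XX T ->
  exists2 W, ant_tens XX W &
    forall S, down S -> (rprod R S `<=` T <-> S `<=` W).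
Proof.
move=> pc [Rs Rd] /ant_tensP[[Ts Td] T1 T2].
exists [set p | dom p /\ forall a b, R (a, b) -> b <= p.1 -> T (a, p.2)].
- apply/ant_tensP; split.
  + split=> [p []//|p q [_ Hp] Dq l1 l2]; split=> // a b Rab bq.
    apply: Td (Hp a b Rab (le_trans bq l1)) _ _ _ => //=.
    by split; [case: (Rs _ Rab)|case: Dq].
  + move=> x Y [y0 Yy0] H; split.
      have [[/= nx _] _] := H _ Yy0; split=> //=; apply: nzB_sup; last by exists y0.
      by move=> y /H [[]].
    move=> a b /= Rab bx; apply: T1; first by exists y0.
    by move=> y /H [_ /=]; apply; eassumption.
  + move=> y X XXX X0 H; split.
      case: (X0) => x [Xx nx]; have [[/= _ ny] _] := H x Xx nx.
      by split=> //=; exact: dom_sup.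
    move=> a b /= Rab bX'; have [/= na nb] := Rs _ Rab.
    have [|x Xx bx0] := @meets_sup _ _ b X pc; first by rewrite (meet_l bX').
    have [|_ /= HT] := H x Xx.
      by move=> -[_ x0]; case/eqP: bx0; rewrite x0 meetx0.
    apply: (HT a (b `&` x)); last exact: leIr.
    by apply: (Rd _ _ Rab) => //=; exact: leIl.
- move=> S [Ss Sd]; split=> [RST p Sp|SW p [b [Rb Sb]]].
    split; first exact: Ss.
    move=> a b Rab bp; apply: RST; exists b; split=> //=.
    have [/= _ nb] := Rs _ Rab.
    apply: (Sd _ _ Sp) => //; split=> /=; first exact: nzB_dom.
    by case: (Ss _ Sp).
  have [_ /= H] := SW _ Sb.
  by have := H p.1 b Rb (lexx _); case: (p).
Qed.

(** The pairs that have no common lower bound in the domain with a pair of [T]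
    form the pseudocomplement of [T] among down-sets. It is closed because a
    nonzero meet with a join contains a nonzero meet with a joinand. *)
Lemma ant_tens_pseudocomplement T :
  pseudocomplemented B ->
  ant_tens XX [set p | dom p /\
    forall q, T q -> ~ bX (q.1 `&` p.1) -> q.2 `&` p.2 = \bot].
Proof.
move=> pc; apply/ant_tensP; split.
- split=> [p []//|p q [_ Hp] Dq l1 l2]; split=> // r Tr nr.
  apply/eqP; rewrite -lex0 -(Hp r Tr); first by rewrite leI2.
  by apply: dom_up nr; rewrite leI2.
- move=> x Y [y0 Yy0] H; split.
    have [[/= nx _] _] := H _ Yy0; split=> //=; apply: nzB_sup; last by exists y0.
    by move=> y /H [[]].
  move=> q Tq /= nq; have := pc; rewrite pseudocomplementedP; apply.
  by move=> y /H [_ /(_ _ Tq)]; apply.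
- move=> y X XXX X0 H; split.
    case: (X0) => x [Xx nx]; have [[/= _ ny] _] := H x Xx nx.
      by split=> //=; exact: dom_sup.
  move=> q Tq /= nq; have [x [Xx nx qx]] := dom_meets_sup pc X0 nq.
  by have [_ /(_ _ Tq)] := H _ Xx nx; apply.
Qed.

End ClosedRelations.

(** * Posets represented by closed relations *)

Section Represented.
Context d (B : completeLatticeType d) (XX : set (set B)).
Context d' (P : porderType d') (rel : P -> set (B * B)).

(** The common core of all the posets compared in the theorem: an order
    isomorphism onto the closed relations ordered by inclusion. *)
Definition represents : Prop :=
  [/\ forall p q, p <= q <-> rel p `<=` rel q,
      forall p, ant_tens XX (rel p) &
      forall T, ant_tens XX T -> exists p, rel p = T].

(** Stated as an adjunction, so that the least closed relation containing the
    relation product, which represents [mul x y], need not be named. *)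
Definition represents_mul (mul : P -> P -> P) : Prop :=
  forall x y z, mul x y <= z <-> rprod (rel x) (rel y) `<=` rel z.

Hypothesis rep : represents.

Lemma represents_le p q : p <= q <-> rel p `<=` rel q.
Proof. by case: rep. Qed.

Lemma represents_closed p : ant_tens XX (rel p).
Proof. by case: rep. Qed.

Lemma represents_onto T : ant_tens XX T -> exists p, rel p = T.
Proof. by case: rep => _ _; apply. Qed.

Lemma represents_complete : complete_poset P.
Proof.
move=> X; set F := [set T | exists2 q, ubound X q & rel q = T].
have [|s srel] := @represents_onto [set p | (~` botX XX `*` nzB B)%classic p /\
                                            forall T, F T -> T p].
  by apply: ant_tens_cap => _ [q _ <-]; exact: represents_closed.
exists s; split=> [p Xp|q Xq]; apply/represents_le; rewrite srel => u.
  move=> pu; split=> [|_ [q Xq <-]].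
    by have [+ _] := ant_tens_down (represents_closed p); apply.
  by have /represents_le := Xq _ Xp; apply.
by case=> _; apply; exists q.
Qed.

Lemma represents_least p : lbound [set: P] p <-> rel p = set0.
Proof.
have [z z0] := represents_onto (ant_tens0 XX).
split=> [least|p0 q _]; last by apply/represents_le; rewrite p0.
by apply/seteqP; split=> //; rewrite -z0; apply/represents_le/least.
Qed.

Lemma represents_meet_is_least p q :
  meet_is_least p q <-> forall u, rel p u -> rel q u -> False.
Proof.
have [|m mrel] := @represents_onto
    [set u | (~` botX XX `*` nzB B)%classic u /\
             forall T, [set rel p; rel q] T -> T u].
  by apply: ant_tens_cap => _ [] ->; exact: represents_closed.
have [z z0] := represents_onto (ant_tens0 XX).
split=> [[w [_ wglb] /represents_least w0] u pu qu|disj].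
  have : rel m u.
    rewrite mrel; split=> [|_ [] -> //].
    by have [+ _] := ant_tens_down (represents_closed p); apply.
  suff /represents_le : m <= w by rewrite w0; apply.
  apply: wglb => _ [] ->; apply/represents_le; rewrite mrel => v [_].
    by apply; left.
  by apply; right.
have zleast : lbound [set: P] z by exact/represents_least.
exists z => //; split=> [r _|r rlb]; first exact: zleast.
apply/represents_le; rewrite z0 => u ru; apply: (disj u).
  by move: u ru; apply/represents_le/rlb; left.
by move: u ru; apply/represents_le/rlb; right.
Qed.

Lemma represents_pseudocomplemented :
  pseudocomplemented B -> pseudocomplemented P.
Proof.
move=> pc p; have [s srel] :=
  represents_onto (ant_tens_pseudocomplement XX (rel p) pc).
have dn q : downset_in _ (rel q) := ant_tens_down (represents_closed q).
have domP q u : rel q u -> (~` botX XX `*` nzB B)%classic u.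
  by have [+ _] := dn q; apply.
exists s.
  apply/represents_meet_is_least => u pu; rewrite srel => -[[nu1 nu2] H].
  have := H u pu; rewrite !meetxx => /(_ nu1) u0.
  by move/eqP: nu2.
move=> q /represents_meet_is_least pq; apply/represents_le; rewrite srel => u qu.
split; first exact: domP qu.
move=> v pv nuv; apply/eqP; apply: contrapT => /negP nz.
have Dm : (~` botX XX `*` nzB B)%classic (v.1 `&` u.1, v.2 `&` u.2) by [].
apply: (pq (v.1 `&` u.1, v.2 `&` u.2)).
  by have [_ dnp] := dn p; apply: dnp pv Dm _ _; exact: leIl.
by have [_ dnq] := dn q; apply: dnq qu Dm _ _; exact: leIr.
Qed.

(** Residuals give distributivity, and associativity as well: both sides of
    the associative law lie below [w] exactly when the triple relation product
    is contained in the relation of [w]. *)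
Lemma represents_quantale mul :
  represents_mul mul -> pseudocomplemented B -> is_quantale mul.
Proof.
move=> mulP pc; pose D := (~` botX XX `*` nzB B)%classic.
have dn q : downset_in D (rel q) := ant_tens_down (represents_closed q).
have resl x z : exists r, forall S, downset_in D S ->
    (rprod (rel x) S `<=` rel z <-> S `<=` rel r).
  have [W cW WP] := residual_right pc (dn x) (represents_closed z).
  by have [r rW] := represents_onto cW; exists r; rewrite rW.
have resr x z : exists r, forall R, downset_in D R ->
    (rprod R (rel x) `<=` rel z <-> R `<=` rel r).
  have [W cW WP] := residual_left pc (dn x) (represents_closed z).
  by have [r rW] := represents_onto cW; exists r; rewrite rW.
apply: residuated_quantale.
- exact: represents_complete.
- have eq_of_le (u v : P) : (forall w, u <= w <-> v <= w) -> u = v.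
    by move=> uv; apply: le_anti; apply/andP; split; apply/uv.
  move=> x y z; apply: eq_of_le => w.
  have [r rP] := resl x w; have [s sP] := resr z w.
  apply: (@iff_trans _ (rprod (rel x) (rprod (rel y) (rel z)) `<=` rel w)).
    rewrite mulP rP // -represents_le mulP rP //; exact: rprod_down.
  rewrite rprodA mulP sP; last exact: rprod_down.
  by rewrite sP // -represents_le mulP.
- move=> x z; have [r rP] := resl x z.
  by exists r => y; rewrite mulP rP // represents_le.
- move=> x z; have [r rP] := resr x z.
  by exists r => y; rewrite mulP rP // represents_le.
Qed.

End Represented.

Section Rectangles.
Context d (B : completeLatticeType d).
Implicit Types (x y : B).

Lemma domT : (~` @botX d B setT)%classic = nzB B.
Proof.
by apply/seteqP; split=> x => [nx|/eqP nx [_]//]; apply/eqP => x0; apply: nx.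
Qed.

Lemma botXT x : ~ botX setT x <-> nzB B x.
Proof. by rewrite -domT. Qed.

(** For the family of all subsets the two coordinates play symmetric roles:
    both avoid [\bot] and admit all nonempty joins. *)
Lemma ant_tensT T : ant_tens setT T <->
  [/\ downset_in (nzB B `*` nzB B) T,
      forall x Y, Y !=set0 -> (forall y, Y y -> T (x, y)) ->
        T (x, supremum \bot Y) &
      forall y X, X !=set0 -> (forall x, X x -> T (x, y)) ->
        T (supremum \bot X, y)].
Proof.
rewrite ant_tensP domT.
split=> -[Td T1 T2]; split=> //.
  move=> y X [x0 Xx0] H; apply: T2 => // [|x Xx _]; last exact: H.
  exists x0; split=> //; apply/botXT; have [Ts _] := Td.
  by case: (Ts _ (H _ Xx0)).
move=> y X _ [x0 [Xx0 /botXT nx0]] H; rewrite -supremum_nz; apply: T2.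
  by exists x0.
by move=> x [Xx nx]; apply: H => //; apply/botXT.
Qed.

Definition rect (a b : B) : set (B * B) :=
  [set p | (nzB B `*` nzB B) p /\ p.1 <= a /\ p.2 <= b].

Lemma ant_tens_rect a b : ant_tens setT (rect a b).
Proof.
apply/ant_tensT; split.
- split=> [p []//|p q [_ [pa pb]] Dq l1 l2].
  by split=> //; split; [exact: le_trans pa|exact: le_trans pb].
- move=> x Y [y0 Yy0] H; have [[/= nx _] [xa _]] := H _ Yy0.
  split; last by split=> //=; apply: sup_le => y /H [_ []].
  by split=> //=; apply: nzB_sup; [move=> y /H [[]]|exists y0].
- move=> y X [x0 Xx0] H; have [[/= _ ny] [_ yb]] := H _ Xx0.
  split; last by split=> //=; apply: sup_le => x /H [_ []].
  by split=> //=; apply: nzB_sup; [move=> x /H [[]]|exists x0].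
Qed.

Context d' (P : porderType d') (rel : P -> set (B * B)).
Hypothesis rep : represents setT rel.

(** Bounding one coordinate by [x] embeds [B] into the closed relations, in
    two ways. Joins are preserved because closedness in the bounded coordinate
    is closure under joins. *)
Lemma rect_embeddings : exists g h : B -> P,
  [/\ (forall x, rel (g x) = rect \top x) /\
      (forall y, rel (h y) = rect y \top),
      join_preserving g /\ order_embedding g &
      join_preserving h /\ order_embedding h].
Proof.
have /choice [g gE] x := represents_onto rep (ant_tens_rect \top x).
have /choice [h hE] y := represents_onto rep (ant_tens_rect y \top).
have nz1 x : nzB B x -> nzB B \top by move=> nx; apply: nzB_up (lex1 x).
have embg : order_embedding g.
  move=> x y; apply/idP/idP => [|xy].
    move/(represents_le rep); rewrite !gE => sub.
    have [->|nx] := eqVneq x \bot; first exact: le0x.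
    have [|_ []//] := sub (\top, x).
    by split=> //; split=> //; exact: nz1 nx.
  apply/(represents_le rep); rewrite !gE => p [Dp [p1 p2]].
  by split=> //; split=> //; exact: le_trans xy.
have embh : order_embedding h.
  move=> x y; apply/idP/idP => [|xy].
    move/(represents_le rep); rewrite !hE => sub.
    have [->|nx] := eqVneq x \bot; first exact: le0x.
    have [|_ []//] := sub (x, \top).
    by split=> //; split=> //; exact: nz1 nx.
  apply/(represents_le rep); rewrite !hE => p [Dp [p1 p2]].
  by split=> //; split=> //; exact: le_trans xy.
exists g, h; split=> //; split=> // X s Xs; split.
- by move=> _ [x Xx <-]; rewrite embg; case: Xs => + _; apply.
- move=> q qub; apply/(represents_le rep).
  rewrite gE => -[a b] [[na nb] /= [_ bs]].
  have /ant_tensT [[_ qd] q1 _] := represents_closed rep q.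
  have qX y : (X `&` nzB B) y -> rel q (\top, y).
    case=> Xy ny; have /(represents_le rep) : g y <= q by apply: qub; exists y.
    by apply; rewrite gE; split=> //; split=> //; exact: nz1 ny.
  rewrite -(supremum_unique Xs) in bs.
  have := q1 \top (X `&` nzB B) (sup_nz_ex (nzB_up nb bs)) qX.
  by rewrite supremum_nz => /qd; apply=> //; exact: lex1.
- by move=> _ [x Xx <-]; rewrite embh; case: Xs => + _; apply.
- move=> q qub; apply/(represents_le rep).
  rewrite hE => -[a b] [[na nb] /= [as_ _]].
  have /ant_tensT [[_ qd] _ q2] := represents_closed rep q.
  have qX x : (X `&` nzB B) x -> rel q (x, \top).
    case=> Xx nx; have /(represents_le rep) : h x <= q by apply: qub; exists x.
    by apply; rewrite hE; split=> //; split=> //; exact: nz1 nx.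
  rewrite -(supremum_unique Xs) in as_.
  have := q2 \top (X `&` nzB B) (sup_nz_ex (nzB_up na as_)) qX.
  by rewrite supremum_nz => /qd; apply=> //; exact: lex1.
Qed.

(** A product of these rectangles relates [\top] to [\top] through any nonzero
    element below both [x] and [y]. *)
Lemma rprod_rect x y :
  rprod (rect \top x) (rect y \top) = set0 <-> x `&` y = \bot.
Proof.
split=> [e|xy0].
  apply/eqP; apply: contrapT => /negP nz.
  have n1 : nzB B \top by apply: nzB_up (lex1 (x `&` y)).
  suff : rprod (rect \top x) (rect y \top) (\top, \top) by rewrite e.
  by exists (x `&` y); split; split=> //; split=> //=; [exact: leIl|exact: leIr].
apply/seteqP; split=> // p [b [[[_ nb] [_ bx]] [_ [/= by_ _]]]].
by case/negP: nb; rewrite -lex0 -xy0 lexI bx.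
Qed.

Lemma represents_mul_disjoint mul g h :
  represents_mul rel mul -> (forall x, rel (g x) = rect \top x) ->
  (forall y, rel (h y) = rect y \top) ->
  forall x y, x `&` y = \bot <-> lbound [set: P] (mul (g x) (h y)).
Proof.
move=> mulP gE hE x y.
have [z z0] := represents_onto rep (ant_tens0 setT).
rewrite -rprod_rect -gE -hE; split=> [e q _|least].
  by apply/mulP; rewrite e.
by apply/seteqP; split=> //; rewrite -z0; apply/mulP/least.
Qed.

Lemma pseudocomplemented_of_represented_quantale mul :
  represents_mul rel mul -> is_quantale mul -> pseudocomplemented B.
Proof.
move=> mulP qm; have [g [h [[gE hE] _ [hjoin _]]]] := rect_embeddings.
apply: (pseudocomplemented_of_quantale qm hjoin).
exact: represents_mul_disjoint mulP gE hE.
Qed.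

Lemma represented_pseudocomplemented :
  pseudocomplemented P <-> pseudocomplemented B.
Proof.
split; last exact: represents_pseudocomplemented rep.
have [g [h [[_ hE] _ [hjoin _]]]] := rect_embeddings.
apply: (pseudocomplemented_pullback hjoin) => x y.
rewrite (represents_meet_is_least rep); split=> [xy0 u|disj].
  rewrite !hE => -[[nu _] [ux _]] [_ [uy _]].
  by case/negP: nu; rewrite -lex0 -xy0 lexI ux.
apply/eqP; apply: contrapT => /negP nz.
have n1 : nzB B \top by apply: nzB_up (lex1 (x `&` y)).
by apply: (disj (x `&` y, \top)); rewrite hE; split=> //; split=> //=;
  [exact: leIl|exact: leIr].
Qed.

Lemma represented_quantale mul :
  represents_mul rel mul -> (is_quantale mul <-> pseudocomplemented B).
Proof.
move=> mulP; split; first exact: pseudocomplemented_of_represented_quantale.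
exact: represents_quantale rep _ mulP.
Qed.

End Rectangles.

(** * The four representations *)

Section AntRepresentation.
Context d (B : completeLatticeType d) (XX : set (set B)).

Lemma ant_condP (f : ant XX) : ant_cond XX f.
Proof. exact: asboolW (ant_valP f). Qed.

Lemma ant_leP (f g : ant XX) : f <= g <-> forall x, f x <= g x.
Proof. by rewrite -Order.le_val; split=> /lefP. Qed.

(** The empty join of [XX], if present, is what pins down the value at the
    excluded bottom. *)
Lemma ant_botX (f : B -> B) x : ant_cond XX f -> botX XX x -> f x = \top.
Proof.
move=> [_ fX] [X0 ->]; have := fX _ X0.
rewrite image_set0 (_ : supremum \bot set0 = \bot).
  by move=> ->; apply/eqP; rewrite -le1x; apply: (proj2 (infimumsP _)) => y [].
by apply: supremum_unique; split=> [y []|y _]; exact: le0x.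
Qed.

Lemma ant_rel_closed (f : B -> B) : ant_cond XX f -> ant_tens XX (ant_rel XX f).
Proof.
move=> fc; have [anti fX] := fc; apply/ant_tensP; split.
- split=> [p [nx ny _]//|p q [_ _ l] [n1 n2] l1 l2]; split=> //.
  exact: le_trans l2 (le_trans l (anti _ _ l1)).
- move=> x Y [y0 Yy0] H; have [nx _ _] := H _ Yy0; split=> //=.
    by apply: nzB_sup; [move=> y /H []|exists y0].
  by apply: sup_le => y /H [].
- move=> y X XXX X0 H; have [x0 [Xx0 nx0]] := X0; have [_ ny _] := H _ Xx0 nx0.
  split=> //=; first exact: dom_sup X0.
  rewrite fX //; apply: (proj2 (infimumsP _)) => _ [x Xx <-].
  have [bx|nx] := pselect (botX XX x); first by rewrite (ant_botX fc bx) lex1.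
  by have [] := H x Xx nx.
Qed.

(** A closed relation [T] comes from the map sending [x] to the join of its
    section, which belongs to the section unless that is empty. *)
Lemma ant_rel_onto T : ant_tens XX T ->
  exists2 f, ant_cond XX f & ant_rel XX f = T.
Proof.
move=> /ant_tensP [[Ts Td] T1 T2].
pose sec x := [set y | T (x, y)].
pose f x := if `[< botX XX x >] then \top else supremum \bot (sec x).
have fsec x y : ~ botX XX x -> nzB B y -> (y <= f x <-> T (x, y)).
  move=> nx ny; rewrite /f; case: asboolP => // _; split; last exact: sup_ub.
  move=> yf; have [z [Tz _]] := sup_nz_ex (nzB_up ny yf).
  have Tsup : T (x, supremum \bot (sec x)) by apply: T1 => //; exists z.
  exact: (Td _ _ Tsup).
exists f; last first.
  apply/seteqP; split=> [[x y] [/= nx ny yf]|[x y] Txy].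
    by apply/fsec.
  by have [/= nx ny] := Ts _ Txy; split=> //=; apply/fsec.
have anti : {homo f : x y /~ x <= y}.
  move=> x y xy; have [by_|ny] := pselect (botX XX y).
    by rewrite {2}/f; case: asboolP => // _; exact: lex1.
  have nx : ~ botX XX x by exact: dom_up xy ny.
  have [->|nf] := eqVneq (f x) \bot; first exact: le0x.
  apply/fsec => //; apply: (Td (x, f x)) => //=; exact/fsec.
split=> // X XXX; apply: le_anti; apply/andP; split.
  by apply: (proj2 (infimumsP _)) => _ [x Xx <-]; apply/anti/sup_ub.
have [X0|noX] := pselect (X `\` botX XX !=set0).
  set m := infimum _ _; have [->|nm] := eqVneq m \bot; first exact: le0x.
  have nX := dom_sup X0; apply/fsec => //; apply: T2 => // x Xx nx.
  by apply/fsec => //; apply: (proj1 (infimumsP _)); exists x.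
suff bX : botX XX (supremum \bot X).
  by rewrite /f; case: asboolP => // _; exact: lex1.
have Xb x : X x -> botX XX x.
  by move=> Xx; apply: contrapT => nx; apply: noX; exists x.
have [[x Xx]|/set0P/negP/negPn/eqP X0] := pselect (X !=set0); last first.
  split; first by rewrite -X0.
  by apply/eqP; rewrite -lex0 X0 sup_le.
have [XX0 _] := Xb _ Xx; split=> //.
by apply/eqP; rewrite -lex0; apply: sup_le => y /Xb [_ ->].
Qed.

Lemma ant_represents : represents XX (fun f : ant XX => ant_rel XX f).
Proof.
split=> [f g|f|T /ant_rel_onto [f fc fT]].
- rewrite ant_leP; split=> [fg p [n1 n2 l]|sub x].
    by split=> //; exact: le_trans (fg _).
  have [bx|nx] := pselect (botX XX x).
    by rewrite (ant_botX (ant_condP g) bx) lex1.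
  have [->|nf] := eqVneq (f x) \bot; first exact: le0x.
  by have [|_ _] := sub (x, f x).
- exact/ant_rel_closed/ant_condP.
- by exists (Ant (asboolT fc)).
Qed.

Lemma ant_mul_represents (mul : ant XX -> ant XX -> ant XX) :
  is_ant_mul mul ->
  represents_mul (fun f : ant XX => ant_rel XX f) (fun f g => mul g f).
Proof.
move=> mulP f g h; have [_ sub least] := mulP g f.
rewrite (represents_le ant_represents); split=> [le|le].
  exact: subset_trans le.
by apply: least => //; exact: represents_closed ant_represents h.
Qed.

Lemma ant_mul_exists : exists mul, @is_ant_mul d B XX mul.
Proof.
have ex (gf : ant XX * ant XX) : exists h : ant XX, ant_rel XX h =
    [set p | (~` botX XX `*` nzB B)%classic p /\
      forall T, (ant_tens XX T /\
                 rprod (ant_rel XX gf.2) (ant_rel XX gf.1) `<=` T) -> T p].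
  apply: (represents_onto ant_represents).
  by apply: (@ant_tens_cap _ _ _ [set T | _]) => T [].
have [m mE] := choice ex; exists (fun g f => m (g, f)) => g f; rewrite mE; split.
- by apply: (@ant_tens_cap _ _ _ [set T | _]) => T [].
- have closed := represents_closed ant_represents.
  move=> p fgp; split=> [|T [_]]; last by apply.
  have [+ _] := rprod_down (ant_tens_down (closed f)) (ant_tens_down (closed g)).
  by apply.
- by move=> T Tc sub p [_]; apply.
Qed.

End AntRepresentation.

Section TensorRepresentations.
Context d (B : completeLatticeType d).

Lemma ctens_leP (R S : ctens B) : R <= S <-> (R : set _) `<=` S.
Proof. by rewrite -Order.le_val qB_leP. Qed.

Lemma ctens_inj (R S : ctens B) : (R : set _) = S -> R = S.
Proof. by move=> e; apply: val_inj; apply: qB_eqP. Qed.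

Lemma t_fix_closed (R : qB B) : t R = R <-> ant_tens setT (R : set _).
Proof.
rewrite t_fixP ant_tensT; have [Rs Rd] := qB_down R; split=> [H|[_ R1 R2]].
- split=> // [x Y Y0 HY|y X X0 HX].
    have [y0 Yy0] := Y0; have [/= nx _] := Rs _ (HY _ Yy0).
    rewrite -(supremum1 x); apply: H => //; first by move=> _ ->.
    + by move=> y /HY /Rs [].
    + by exists x.
    + by move=> [a b] [/= -> /HY].
  have [x0 Xx0] := X0; have [/= _ ny] := Rs _ (HX _ Xx0).
  rewrite -(supremum1 y); apply: H => //.
  + by move=> x /HX /Rs [].
  + by move=> _ ->.
  + by exists y.
  + by move=> [a b] [/= /HX + ->].
- move=> X Y _ _ X0 Y0 XY; apply: R1 => // y Yy; apply: R2 => // x Xx.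
  exact: XY.
Qed.

Lemma ctens_represents : represents setT (fun R : ctens B => (R : set (B * B))).
Proof.
split=> [R S|R|T Tc]; first exact: ctens_leP.
  by apply/t_fix_closed/eqP; exact: ctens_valP.
have Td : `[< downset_in (nzB B `*` nzB B) T >].
  by apply/asboolP; have [] := (ant_tensT T).1 Tc.
have Tt : t (QB Td) == QB Td by apply/eqP/t_fix_closed.
by exists (CTens Tt).
Qed.

Lemma odot_represents :
  represents_mul (fun R : ctens B => (R : set (B * B))) (@odot d B).
Proof.
move=> R S T; rewrite ctens_leP; split=> le.
  by apply: subset_trans le; apply/(qB_leP (qmul R S) _)/tbar_ext.
by apply/qB_leP/tbar_least; [apply/eqP; exact: ctens_valP|exact/qB_leP].
Qed.

(** An order isomorphism onto [ctens B] makes every statement about the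
    represented posets available for its domain. *)
Lemma iso_represents d' (P : porderType d') (f : P -> ctens B) :
  order_iso f -> represents setT (fun p => (f p : set (B * B))).
Proof.
move=> [[g fK gK] emb]; split=> [p q|p|T].
- by rewrite -ctens_leP emb.
- exact: represents_closed ctens_represents _.
- by move=> /(represents_onto ctens_represents) [R <-]; exists (g R); rewrite gK.
Qed.

Lemma transported_quantaleP d' (P : porderType d') (f : P -> ctens B) :
  order_iso f -> (transported_quantale f (@odot d B) <-> pseudocomplemented B).
Proof.
move=> iso; have [[g fK gK] emb] := iso.
have mulP (mul : P -> P -> P) : {morph f : x y / mul x y >-> odot x y} ->
    represents_mul (fun p => (f p : set (B * B))) mul.
  by move=> fM x y z; rewrite -odot_represents -fM emb.
split=> [[mul fM qm]|pc].
  exact: (represented_quantale (iso_represents iso) (mulP _ fM)).1 qm.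
have fM : {morph f : x y / g (odot (f x) (f y)) >-> odot x y}.
  by move=> x y /=; rewrite gK.
exists (fun x y => g (odot (f x) (f y))) => //.
exact: (represented_quantale (iso_represents iso) (mulP _ fM)).2 pc.
Qed.

(** Every member of [tens B] contains [bot_tens B], as is seen from empty
    joins, so removing and adding these pairs are mutually inverse. *)
Lemma tens_ctens_iso : order_iso (@tens_ctens d B).
Proof.
have bot_sub (T : tens B) p : bot_tens p -> (T : set _) p.
  have [_ Ts] := asboolW (tens_valP T); case: p => a b.
  have s0 : supremum \bot set0 = \bot :> B.
    by apply: supremum_unique; split=> [y []|y _]; exact: le0x.
  case=> /= ->.
    by have := Ts set0 [set b]; rewrite s0 supremum1; apply=> p [].
  by have := Ts [set a] set0; rewrite s0 supremum1; apply=> p [].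
apply: order_isoP => [T S|R].
  apply/idP/idP => [/ctens_leP sub|]; rewrite -Order.le_val.
    apply/asboolP => p Tp.
    have [bp|nb] := pselect (bot_tens p); first exact: bot_sub.
    by have [] := sub p.
  by move/asboolP => sub; apply/ctens_leP => p [/sub Sp nb].
have tR : t R = R by apply/eqP; exact: ctens_valP.
have [Rs Rd] := qB_down R.
have Tc : tens_cond ((R : set _) `|` @bot_tens d B)%classic.
  split.
    split=> // p q Tp _ l1 l2.
    have [bq|nbq] := pselect (bot_tens q); [by right|left].
    have nq1 : q.1 != \bot by apply/eqP => e; apply: nbq; left.
    have nq2 : q.2 != \bot by apply/eqP => e; apply: nbq; right.
    case: Tp => [Rp|[p0|p0]]; first exact: Rd Rp _ _ _.
      by case/negP: nq1; rewrite -lex0 -p0.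
    by case/negP: nq2; rewrite -lex0 -p0.
  move=> X Y XY.
  have [X0|nX] := eqVneq (supremum \bot X) \bot; first by right; left.
  have [Y0|nY] := eqVneq (supremum \bot Y) \bot; first by right; right.
  left; have := (t_fixP R).1 tR (X `&` nzB B)%classic (Y `&` nzB B)%classic.
  rewrite !supremum_nz; apply; try by move=> x [].
  - exact: sup_nz_ex.
  - exact: sup_nz_ex.
  - move=> [a b] [[Xa na] [Yb nb]]; have [//|[/= e|/= e]] := XY (a, b) (conj Xa Yb).
      by move/eqP: na.
    by move/eqP: nb.
exists (Tens (asboolT Tc)); apply: ctens_inj; apply/seteqP; split=> p /=.
  by case=> -[].
by move=> Rp; split; [left|case=> /eqP e; have [/= n1 n2] := Rs _ Rp;
  [case/negP: n1|case/negP: n2]].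
Qed.

(** Galois maps are the antitone maps for all subsets, and the relation
    attached to them is the same. *)
Lemma gal_ctens_iso : order_iso (@gal_ctens d B).
Proof.
have gal_ant (f : B -> B) : gal_cond f -> ant_cond setT f.
  move=> fg; split=> // x y xy.
  have <- : supremum \bot [set y; x] = x.
    by apply: supremum_unique; split=> [z [] ->|z zub] //; apply: zub; right.
  by rewrite fg; apply: (proj1 (infimumsP _)); exists y => //; left.
have relE (f : gal B) : (gal_ctens f : set _) = ant_rel setT f.
  by apply/seteqP; split=> p [n1 n2 l]; split=> //; apply/botXT.
have ga (f : gal B) : ant_cond setT f.
  exact: gal_ant _ (asboolW (gal_valP f)).
apply: order_isoP => [f g|R].
  pose fa := Ant (asboolT (ga f)); pose gb := Ant (asboolT (ga g)).
  have fgE : f <= g <-> fa <= gb by rewrite -!Order.le_val.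
  have relle := represents_le (ant_represents setT) fa gb.
  rewrite /= -!relE -ctens_leP in relle.
  by apply/idP/idP => [/relle/fgE|/fgE/relle].
have [f [_ fX] fR] := ant_rel_onto (represents_closed ctens_represents R).
have fg : gal_cond f by move=> X; exact: fX.
by exists (Gal (asboolT fg)); apply: ctens_inj; rewrite -fR relE.
Qed.

End TensorRepresentations.

(** * Prenuclei on the quantale of relations *)

Section Nuclei.
Context d (B : completeLatticeType d).
Implicit Types (R S : qB B) (x y : B) (X Y : set B).

Lemma cutP X a : X `<=` nzB B -> X !=set0 ->
  cut X a <-> nzB B a /\ a <= supremum \bot X.
Proof.
move=> Xs X0; split=> -[na aX]; split=> //.
  by apply: aX => [|x]; [exact: nzB_sup|exact: sup_ub].
by move=> b _ ub; apply: le_trans aX (sup_le ub).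
Qed.

(** If [(a, b)] lies in [R] and [b] below the join of [X], where [X * Y] lies
    in [S], then some [x] in [X] meets [b], and [a] is related to all of [Y]
    through [x `&` b]. *)
Lemma t_prenucleus : pseudocomplemented B -> prenucleus (@qmul d B) (@t d B).
Proof.
move=> pc; split; first exact: t_preclosure.
move=> R S; split; apply/qB_leP => -[a c] [b []].
  move=> Rab [X [Y [Xs Ys [[x0 y0] [/= Xx0 Yy0]] XY [cb cc]]]].
  move: cb => /= /cutP-/(_ Xs (ex_intro _ _ Xx0)) [nb bX].
  have [|x Xx bx0] := @meets_sup _ _ b X pc; first by rewrite (meet_l bX).
  have [[Rs Rd] [Ss Sd]] := (qB_down R, qB_down S).
  have [/= na _] := Rs _ Rab.
  exists [set a], Y; split=> //; first by move=> _ ->.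
  - by exists (a, y0).
  - move=> [u y] [/= -> Yy]; exists (b `&` x); split=> /=.
      by apply: (Rd _ _ Rab) => //=; exact: leIl.
    apply: (Sd _ _ (XY (x, y) (conj Xx Yy))) => //=; last exact: leIr.
    by split=> //; exact: Ys.
  - by split=> //; apply/cutP => [_ ->//||]; [exists a|rewrite supremum1].
move=> [X [Y [Xs Ys [[x0 y0] [/= Xx0 Yy0]] XY [ca cb]]]] Sbc.
move: cb => /= /cutP-/(_ Ys (ex_intro _ _ Yy0)) [nb bY].
have [|y Yy by0] := @meets_sup _ _ b Y pc; first by rewrite (meet_l bY).
have [[Rs Rd] [Ss Sd]] := (qB_down R, qB_down S).
have [/= _ nc] := Ss _ Sbc.
exists X, [set c]; split=> //; first by move=> _ ->.
- by exists (x0, c).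
- move=> [x v] [/= Xx ->]; exists (b `&` y); split=> /=.
    apply: (Rd _ _ (XY (x, y) (conj Xx Yy))) => //=; last exact: leIr.
    by split=> //; exact: Xs.
  by apply: (Sd _ _ Sbc) => //=; exact: leIl.
- by split=> //; apply/cutP => [_ ->//||]; [exists c|rewrite supremum1].
Qed.

Lemma tbar_closed R : ant_tens setT (tbar R : set _).
Proof. exact/t_fix_closed/t_tbar. Qed.

Lemma tbar_sub R (V : set (B * B)) : ant_tens setT V ->
  (R : set _) `<=` V -> (tbar R : set _) `<=` V.
Proof.
move=> /(represents_onto (ctens_represents B)) [S <-] RS.
apply/(qB_leP (tbar R) S)/tbar_least; last exact/qB_leP.
by apply/eqP; exact: ctens_valP.
Qed.

(** The residual of the closed relation [tbar (qmul R S)] by one factor is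
    closed, so together with the other factor it contains its closure. *)
Lemma tbar_nucleus : pseudocomplemented B -> nucleus (@qmul d B) (@tbar d B).
Proof.
move=> pc; have [[tpre tid] _ _] := tbarP B; split=> //; split=> // R S.
have down U : downset_in (~` botX setT `*` nzB B)%classic (U : qB B).
  by rewrite domT; exact: qB_down.
have mulR : (qmul R S : set _) `<=` tbar (qmul R S).
  by apply/qB_leP/tbar_ext.
split; apply/qB_leP.
  have [W cW WP] := residual_right pc (down R) (tbar_closed (qmul R S)).
  apply: (WP _ (down (tbar S))).2; apply: tbar_sub cW _.
  exact: (WP _ (down S)).1 mulR.
have [Z cZ ZP] := residual_left pc (down S) (tbar_closed (qmul R S)).
apply: (ZP _ (down (tbar R))).2; apply: tbar_sub cZ _.
exact: (ZP _ (down R)).1 mulR.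
Qed.

Lemma t0 : t (q0 B) = q0 B.
Proof.
apply: qB_eqP; apply/seteqP; split=> // p [X [Y [_ _ [u Xu] XY _]]].
exact: XY Xu.
Qed.

Lemma tbar0 : tbar (q0 B) = q0 B.
Proof.
by apply: le_anti; rewrite tbar_ext andbT; apply: tbar_least => //; exact: t0.
Qed.

(** Relate [\top] to the elements below [x], and all elements below some
    member of [Y] to everything. If [x] is disjoint from all of [Y] these
    relations have empty product; but [j] adds the join of [Y] on the left of
    the second one, so [x] is disjoint from the join as well. *)
Lemma pseudocomplemented_of_prenucleus (j : qB B -> qB B) :
  prenucleus (@qmul d B) j -> (forall R, t R <= j R) -> j (q0 B) = q0 B ->
  pseudocomplemented B.
Proof.
move=> [_ jmul] tj j0; apply/pseudocomplementedP => x Y xY.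
apply/eqP; apply: contrapT => /negP nz; set s := supremum _ _ in nz.
have nx : nzB B x by apply: nzB_up nz (leIl _ _).
have n1 : nzB B \top by apply: nzB_up nx (lex1 _).
have Rdown : `[< downset_in (nzB B `*` nzB B) (rect \top x) >].
  by apply/asboolP; have [] := (ant_tensT _).1 (ant_tens_rect \top x).
have Sdown : `[< downset_in (nzB B `*` nzB B)
    [set p | (nzB B `*` nzB B) p /\ exists2 y, Y y & p.1 <= y] >].
  apply/asboolP; split=> [p []//|p q [_ [y Yy py]] Dq l1 _]; split=> //.
  by exists y => //; exact: le_trans py.
have RS0 : qmul (QB Rdown) (QB Sdown) = q0 B.
  apply: qB_eqP; apply/seteqP; split=> // p [b [[[_ nb] [_ /= bx]]]].
  move=> [_ [y /xY xy0 /= by_]].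
  by case/negP: nb; rewrite -lex0 -xy0 lexI bx.
have [/qB_leP jRS _] := jmul (QB Rdown) (QB Sdown).
rewrite RS0 j0 in jRS; apply: (jRS (\top, \top)); exists (x `&` s); split.
  by split=> //; split=> //=; exact: leIl.
have /qB_leP := tj (QB Sdown); apply.
have Ynz : (Y `&` nzB B)%classic !=set0.
  by apply: sup_nz_ex; apply: nzB_up nz _; exact: leIr.
exists (Y `&` nzB B)%classic, [set \top]; split.
- by move=> y [].
- by move=> _ ->.
- by case: Ynz => y Yy; exists (y, \top).
- move=> [y u] [[Yy ny] /= ->]; split=> //=; exists y => //.
- split=> /=; apply/cutP => //.
  + by rewrite supremum_nz; split=> //; exact: leIr.
  + by move=> _ ->.
  + by exists \top.
  + by rewrite supremum1.
Qed.

(** A nucleus whose fixpoints are those of [t] lies above [t], and [q0] is one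
    of these fixpoints. *)
Lemma quantic_quotient_nucleus :
  quantic_quotient (@qmul d B) [set R | t R = R] ->
  exists j : qB B -> qB B,
    [/\ nucleus (@qmul d B) j, forall R, t R <= j R & j (q0 B) = q0 B].
Proof.
move=> [j jn fixE]; have [[[jext jmono] _] jid] := jn.
have fixP R : t R = R <-> j R = R.
  have : [set R | t R = R] R <-> [set R | j R = R] R by rewrite fixE.
  by [].
exists j; split=> // [R|]; last exact/fixP/t0.
have <- : t (j R) = j R by apply/fixP/jid.
exact: (t_preclosure B).2.
Qed.

Lemma tbar_quantic_quotient :
  nucleus (@qmul d B) (@tbar d B) ->
  quantic_quotient (@qmul d B) [set R | t R = R].
Proof.
move=> tn; exists (@tbar d B) => //; apply/seteqP; split=> R /= tR.
  by apply: le_anti; rewrite tbar_ext andbT; apply: tbar_least.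
by rewrite -tR t_tbar.
Qed.

End Nuclei.

(** * The equivalences *)

Section CtensBottom.
Context d (B : completeLatticeType d).

Fact t_q0_fix : t (q0 B) == q0 B. Proof. exact/eqP/t0. Qed.

Fact ctens_bot_le (R : ctens B) : CTens t_q0_fix <= R.
Proof. by apply/ctens_leP. Qed.

HB.instance Definition _ :=
  Order.hasBottom.Build set_display (ctens B) ctens_bot_le.

Lemma lbound_bot d' (Q : bPOrderType d') (q : Q) :
  lbound [set: Q] q <-> q = \bot.
Proof.
split=> [least|-> r _]; last exact: le0x.
by apply: le_anti; rewrite le0x least.
Qed.

(** Realised in [ctens B] by the two families of rectangles. *)
Lemma disjointness_realised : pseudocomplemented B ->
  exists (d' : Order.disp_t) (Q : bPOrderType d')
         (mul : Q -> Q -> Q) (g h : B -> Q),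
    [/\ is_quantale mul, join_preserving g /\ order_embedding g,
        join_preserving h /\ order_embedding h &
        forall x y : B, x `&` y = \bot <-> mul (g x) (h y) = \bot].
Proof.
move=> pc; have rep := ctens_represents B; have mulP := @odot_represents d B.
have [g [h [[gE hE] gP hP]]] := rect_embeddings rep.
exists set_display, (ctens B), (@odot d B), g, h; split=> //.
  exact: (represented_quantale rep mulP).2.
by move=> x y; rewrite (represents_mul_disjoint rep mulP gE hE) lbound_bot.
Qed.

End CtensBottom.

Theorem theorem8p2 (d : Order.disp_t) (B : completeLatticeType d) :
  [/\ order_iso (@tens_ctens d B),
      order_iso (@gal_ctens d B) &
  [<->
    (* (a) *) pseudocomplemented B;
    (* (b) *) prenucleus (@qmul d B) (@t d B);
    (* (c) *) nucleus (@qmul d B) (@tbar d B);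
    (* (d) *) quantic_quotient (@qmul d B) [set R : qB B | t R = R];
    (* (e) *) is_quantale (@odot d B);
              transported_quantale (@tens_ctens d B) (@odot d B);
              transported_quantale (@gal_ctens d B) (@odot d B);
    (* (f) *) pseudocomplemented (ctens B);
              pseudocomplemented (tens B);
              pseudocomplemented (gal B);
    (* (g) *) (exists j : qB B -> qB B,
                [/\ nucleus (@qmul d B) j, forall R, t R <= j R &
                    j (q0 B) = q0 B]);
              (exists j : qB B -> qB B,
                [/\ prenucleus (@qmul d B) j, forall R, t R <= j R &
                    j (q0 B) = q0 B]);
    (* (h) *) (exists (d' : Order.disp_t) (Q : bPOrderType d')
                      (mul : Q -> Q -> Q) (g h : B -> Q),
                [/\ is_quantale mul,
                    join_preserving g /\ order_embedding g,
                    join_preserving h /\ order_embedding h &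
                    forall x y : B,
                      x `&` y = \bot <-> mul (g x) (h y) = \bot]);
    (* (i) *) (forall XX : set (set B), ant_quantale XX);
    (* (j) *) (forall XX : set (set B), pseudocomplemented (ant XX)) ] ].
Proof.
split; [exact: tens_ctens_iso|exact: gal_ctens_iso|].
have ctens_rep := ctens_represents B.
have tens_rep := iso_represents (@tens_ctens_iso d B).
have gal_rep := iso_represents (@gal_ctens_iso d B).
have prenucleus_a (j : qB B -> qB B) :
    [/\ prenucleus (@qmul d B) j, forall R, t R <= j R & j (q0 B) = q0 B] ->
    pseudocomplemented B.
  by case; exact: pseudocomplemented_of_prenucleus.
have nucleus_a (j : qB B -> qB B) :
    [/\ nucleus (@qmul d B) j, forall R, t R <= j R & j (q0 B) = q0 B] ->
    pseudocomplemented B.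
  by case=> -[jp _] tj j0; apply: (prenucleus_a j).
have [_ t_le_tbar _] := tbarP B.
have e_a := represented_quantale ctens_rep (@odot_represents d B).
have h_a : (exists (d' : Order.disp_t) (Q : bPOrderType d')
                   (mul : Q -> Q -> Q) (g h : B -> Q),
    [/\ is_quantale mul, join_preserving g /\ order_embedding g,
        join_preserving h /\ order_embedding h &
        forall x y : B, x `&` y = \bot <-> mul (g x) (h y) = \bot]) ->
    pseudocomplemented B.
  move=> [d' [Q [mul [g [h [qm _ [hjoin _] gh]]]]]].
  apply: (pseudocomplemented_of_quantale (g := g) qm hjoin) => x y.
  by rewrite gh lbound_bot.
tfae.
- exact: t_prenucleus.
- move=> tp; apply/tbar_nucleus/(prenucleus_a (@t d B)).
  by split=> //; exact: t0.
- exact: tbar_quantic_quotient.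
- by move=> /quantic_quotient_nucleus [j /nucleus_a] /e_a.
- by move=> /e_a /(transported_quantaleP (@tens_ctens_iso d B)).
- move=> /(transported_quantaleP (@tens_ctens_iso d B)).
  by move=> /(transported_quantaleP (@gal_ctens_iso d B)).
- move=> /(transported_quantaleP (@gal_ctens_iso d B)).
  by move=> /(represented_pseudocomplemented ctens_rep).
- move=> /(represented_pseudocomplemented ctens_rep).
  by move=> /(represented_pseudocomplemented tens_rep).
- move=> /(represented_pseudocomplemented tens_rep).
  by move=> /(represented_pseudocomplemented gal_rep).
- move=> /(represented_pseudocomplemented gal_rep) pc.
  by exists (@tbar d B); split=> //; [exact: tbar_nucleus|exact: tbar0].
- by move=> [j [[jp _] tj j0]]; exists j.
- by move=> [j /prenucleus_a]; exact: disjointness_realised.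
- move=> /h_a pc XX; have [mul mulP] := ant_mul_exists XX; exists mul => //.
  (* [mul g f] multiplies the relation of [f] by that of [g]. *)
  apply: (@is_quantale_opp _ _ (fun f g => mul g f)).
  exact: represents_quantale (ant_represents XX) _ (ant_mul_represents mulP) pc.
- move=> quant XX; have [mul mulP qm] := quant setT.
  apply: represents_pseudocomplemented (ant_represents XX) _.
  apply/(represented_quantale (ant_represents setT) (ant_mul_represents mulP)).
  exact: is_quantale_opp.
- by move=> /(_ setT) /(represented_pseudocomplemented (ant_represents setT)).
Qed.
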